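(* Let $G=\langle x\rangle\neq 1$ be a finite cyclic group, let $o(x)$ denote the order of $x$, and let $m\geq 2$ be an integer. Then $G$ admits an O$m$SR of valency $3$, except when either: (i) $o(x)=2$ and $m\leq 4$; or (ii) $o(x)\in\{3,4\}$ and $m=2$. That is, $G$ admits an O$m$SR of valency $3$ if and only if neither (i) nor (ii) holds.
   Context: A digraph $\Gamma$ is a pair $(V(\Gamma),A(\Gamma))$ with $V(\Gamma)$ a non-empty (here finite) vertex set and $A(\Gamma)\subseteq V(\Gamma)\times V(\Gamma)$ its set of arcs; if $(u,v)\in A(\Gamma)$ then $v$ is an out-neighbor of $u$ and $u$ is an in-neighbor of $v$. The out-valency (in-valency) of a vertex is the number of its out-neighbors (in-neighbors). $\Gamma$ is $k$-regular, or regular of valency $k$, if every vertex has out-valency and in-valency both equal to $k$. $\Gamma$ is oriented if for all vertices $u,v$ at most one of $(u,v)$, $(v,u)$ is an arc when $u\neq v$, and there are no loops (no arc $(u,u)$). An automorphism of $\Gamma$ is a permutation $\sigma$ of $V(\Gamma)$ such that $(u,v)\in A(\Gamma)\iff(u^\sigma,v^\sigma)\in A(\Gamma)$; these form the full automorphism group $\mathrm{Aut}(\Gamma)$. A permutation group acts semiregularly if all its point stabilizers are trivial. For a finite group $G$ and a positive integer $m$, an $m$-Cayley digraph over $G$ is a digraph having a group of automorphisms isomorphic to $G$ that acts semiregularly on the vertex set with exactly $m$ orbits. Equivalently, up to isomorphism, it is the digraph with vertex set $G\times\mathbb{Z}_m$ and arc set $\bigcup_{i,j\in\mathbb{Z}_m}\{((g,i),(tg,j))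 : g\in G,\ t\in T_{i,j}\}$ for some subsets $T_{i,j}\subseteq G$ ($i,j\in\mathbb{Z}_m$); it is oriented exactly when $T_{i,j}\cap T_{j,i}^{-1}=\emptyset$ for all $i,j\in\mathbb{Z}_m$ (including $i=j$). $G$ admits an oriented $m$-semiregular representation (O$m$SR) of valency $k$ if there exists an oriented $k$-regular $m$-Cayley digraph $\Gamma$ over $G$ with $\mathrm{Aut}(\Gamma)\cong G$. *)

(* Defs.v *)
From HB Require Import structures.
From mathcomp Require Import all_boot all_fingroup.

Set Implicit Arguments.
Unset Strict Implicit.
Unset Printing Implicit Defensive.

Import GroupScope.

Record digraph := Digraph {
  vertex : finType;
  arc : rel vertex;
  vertex_gt0 : 0 < #|vertex|
}.

Section DigraphTheory.

Variable Gamma : digraph.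

Definition out_neighbors (u : vertex Gamma) : {set vertex Gamma} :=
  [set v | arc u v].

Definition in_neighbors (v : vertex Gamma) : {set vertex Gamma} :=
  [set u | arc u v].

Definition regular (k : nat) : Prop :=
  forall v : vertex Gamma, #|out_neighbors v| = k /\ #|in_neighbors v| = k.

Definition oriented : Prop :=
  (forall u v : vertex Gamma, u != v -> ~~ (arc u v && arc v u)) /\
  (forall u : vertex Gamma, ~~ arc u u).

Definition aut_digraph : {set {perm vertex Gamma}} :=
  [set s : {perm vertex Gamma} |
    [forall u : vertex Gamma, forall v : vertex Gamma,
      arc (s u) (s v) == arc u v]].

Lemma aut_digraph_group_set : group_set aut_digraph.
Proof.
apply/group_setP; split=> [|s t].
  by rewrite inE; apply/forallP=> u; apply/forallP=> v; rewrite !perm1.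
rewrite !inE => /forallP Hs /forallP Ht.
apply/forallP=> u; apply/forallP=> v; rewrite !permM.
by rewrite (eqP (forallP (Ht (s u)) (s v))) (eqP (forallP (Hs u) v)).
Qed.

Canonical aut_digraph_group := Group aut_digraph_group_set.

End DigraphTheory.

Definition semiregular_perm (T : finType) (H : {group {perm T}}) : Prop :=
  forall x : T, 'C_H[x | 'P] = 1.

Definition num_orbits (T : finType) (H : {group {perm T}}) : nat :=
  #|[set orbit 'P H x | x : T]|.

Definition mCayley_digraph (gT : finGroupType) (G : {group gT}) (m : nat)
    (Gamma : digraph) : Prop :=
  exists H : {group {perm vertex Gamma}},
    [/\ H \subset aut_digraph Gamma, H \isog G,
        semiregular_perm H & num_orbits H = m].

Definition admits_OmSR (gT : finGroupType) (G : {group gT}) (m k : nat) : Prop :=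
  exists Gamma : digraph,
    [/\ oriented Gamma, regular Gamma k, mCayley_digraph G m Gamma
      & aut_digraph Gamma \isog G].

(* Main.v *)
(** The digraph exists exactly when [#[x] * m >= 9].  For [N = #[x] * m >= 9],
    start from the circulant on Z/N with connection set {1, 2, 4} and, at every
    multiple [u] of [m], replace the arcs [u -> u+4] and [u+1 -> u+3] by
    [u -> u+3] and [u+1 -> u+4].  An arc [u -> w] is then contained in no
    transitive triangle [u -> v -> w] if and only if [w = u + 1], so every
    automorphism is a translation; as it preserves the switched positions, it
    is a translation by a multiple of [m].

    Conversely an oriented 3-regular digraph has at least 7 vertices, which
    leaves 8 vertices and a group of order 2 or 4.  The unique vertex not
    adjacent to [v] is then the image of [v] under an involution [tau] of the
    group, so 12 bits determine the digraph, and in each regular case there is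
    a nontrivial automorphism that fixes a vertex or has order not dividing 4. *)

Require Import Defs.
From HB Require Import structures.
From mathcomp Require Import all_boot all_fingroup all_solvable all_algebra zify.

Set Implicit Arguments.
Unset Strict Implicit.
Unset Printing Implicit Defensive.

Import GRing.Theory.

(** * The switched circulant and its automorphisms *)

Section ShiftedCirculant.

Variables (N : nat) (D : pred 'Z_N).
Hypothesis N_gt8 : 8 < N.
Hypothesis D_sparse : forall u : 'Z_N, D u -> ~~ D (u + 1)%R.

(* [D] is the set of switched positions. *)
Definition steps (u : 'Z_N) : seq nat :=
  [:: 1; if D (u - 1)%R then 3 else 2; if D u then 3 else 4].

Definition step_arc : rel 'Z_N :=
  fun u v => v \in [seq (u + k%:R)%R | k <- steps u].

Lemma card_Zp_gt0 : 0 < #|'Z_N|. Proof. by rewrite card_ord. Qed.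

Definition step_digraph := Digraph step_arc card_Zp_gt0.

Lemma step_arcP (u v : 'Z_N) :
  reflect (exists2 k, k \in steps u & v = (u + k%:R)%R) (step_arc u v).
Proof. exact: mapP. Qed.

Lemma steps_bound u k : k \in steps u -> 0 < k <= 4.
Proof. by rewrite !inE => /or3P[]/eqP-> //; case: ifP. Qed.

(** A sum of two steps is at most 8 < [N], so offsets can be compared as natural numbers, without
    wrap-around. *)
Lemma addr_nat_inj (u : 'Z_N) i j :
  i < 9 -> j < 9 -> (u + i%:R = u + j%:R)%R -> i = j.
Proof.
have val9 k : k < 9 -> nat_of_ord (k%:R : 'Z_N)%R = k.
  by move=> k9; rewrite val_Zp_nat ?modn_small ?(leq_trans _ N_gt8).
by move=> /val9 iE /val9 jE /addrI/(congr1 (@nat_of_ord _)); rewrite iE jE.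
Qed.

Lemma step_oriented : oriented step_digraph.
Proof.
have no2 (u v : 'Z_N) : step_arc u v -> ~~ step_arc v u.
  case/step_arcP=> i /steps_bound/andP[i0 i4] ->; apply/step_arcP=> -[j].
  case/steps_bound/andP=> j0 j4; rewrite -addrA -natrD -[u in u = _]addr0.
  move/(@addr_nat_inj u 0 (i + j) isT); rewrite ltnS (leq_add i4 j4) => /(_ isT).
  by case: i i0 {i4}.
split=> [u v _ | u]; first by apply/andP=> -[/no2/negP].
by apply/negP=> uu; move/negP: (no2 _ _ uu).
Qed.

Lemma step_out_card (u : 'Z_N) : #|out_neighbors (Gamma := step_digraph) u| = 3.
Proof.
rewrite (eq_card (B := mem ([seq (u + k%:R)%R | k <- steps u] : seq 'Z_N))); last first.
  by move=> v; rewrite inE.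
apply/card_uniqP; rewrite map_inj_in_uniq /=.
  rewrite !inE; case: ifP => Du1; case: ifP => Du //.
  by have:= D_sparse Du1; rewrite subrK Du.
move=> i j /steps_bound/andP[_ i4] /steps_bound/andP[_ j4].
by apply: addr_nat_inj; apply: (@leq_ltn_trans 4).
Qed.

Lemma step_in_card (v : 'Z_N) : #|in_neighbors (Gamma := step_digraph) v| = 3.
Proof.
have [w ->] : exists w, v = (w + 4%:R)%R by exists (v - 4%:R)%R; rewrite subrK.
(* Offsets from [w] of the in-neighbours of [w + 4]: a switch at [w + 1] replaces [w + 2] by
   [w + 1], and a switch at [w] replaces [w] by [w + 1]. *)
pose s := [:: 3; if D (w + 1)%R then 1 else 2; if D w then 1 else 0].
have wS i : (w + i.+1%:R - 1 = w + i%:R)%R by rewrite -natr1 addrA addrK.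
rewrite (eq_card (B := mem ([seq (w + k%:R)%R | k <- s] : seq 'Z_N))).
  apply/card_uniqP; rewrite map_inj_in_uniq /=.
    rewrite !inE; case: ifP => Dw1; case: ifP => Dw //.
    by have:= D_sparse Dw; rewrite Dw1.
  have s3 k : k \in s -> k < 9 by rewrite !inE => /or3P[]/eqP-> //; case: ifP.
  by move=> i j /s3 i9 /s3 j9; apply: addr_nat_inj.
have s_steps k : k <= 4 -> (k \in s) = (4 - k \in steps (w + k%:R)%R).
  by case: k => [|[|[|[|[|//]]]]] _; rewrite !inE ?wS ?addr0; do !case: ifP.
move=> u; rewrite inE; apply/step_arcP/mapP=> -[k ks].
  have k4: k <= 4 by case/andP: (steps_bound ks).
  rewrite -{1}(subnK k4) natrD addrA => /addIr uE.
  by exists (4 - k); rewrite ?s_steps ?leq_subr // subKn ?uE.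
have k4 : k <= 4 by move: ks; rewrite !inE => /or3P[]/eqP-> //; case: ifP.
move=> ->; exists (4 - k); first by rewrite -s_steps.
by rewrite -addrA -natrD subnKC.
Qed.

(** Two steps sum to a number between 2 and 8, never to 1 modulo [N]; every step 2, 3 or 4 splits
    into two steps, in a way that depends on the switches at [u - 1], [u] and [u + 1]. Hence the
    successor map is determined by the arcs. *)
Lemma step_succP (u w : 'Z_N) :
  reflect (w = u + 1)%R
    (step_arc u w && [forall v, ~~ (step_arc u v && step_arc v w)]).
Proof.
have wS (x : 'Z_N) i : (x + i.+1%:R - 1 = x + i%:R)%R by rewrite -natr1 addrA addrK.
have in2 i j k : i \in steps u -> j \in steps (u + i%:R)%R -> i + j = k ->
  exists v, step_arc u v && step_arc v (u + k%:R)%R.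
  move=> iu ju <-; exists (u + i%:R)%R; apply/andP; split; apply/step_arcP.
    by exists i.
  by exists j; rewrite // natrD addrA.
apply: (iffP andP) => [[/step_arcP[k ku ->] /forallP no2] | ->].
  suff [-> // | [v]] : k = 1 \/ exists v, step_arc u v && step_arc v (u + k%:R)%R.
    by rewrite (negPf (no2 v)).
  have s1 x : 1 \in steps x by rewrite inE.
  have := ku; rewrite inE; case/predU1P=> [| k_gt1]; [by left | right].
  have [Du1 | nDu1] := boolP (D (u - 1)%R).
    have nDu : ~~ D u by rewrite -(subrK 1 u)%R D_sparse.
    move: k_gt1; rewrite !inE Du1 (negPf nDu) => /orP[]/eqP->.
      by apply: (in2 1 2); rewrite ?s1 // !inE addrK (negPf nDu).
    by apply: (in2 3 1); rewrite ?s1 // !inE Du1.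
  have s2 : 2 \in steps u by rewrite !inE (negPf nDu1).
  move: k_gt1; rewrite !inE (negPf nDu1) => /orP[]/eqP->.
    by apply: (in2 1 1); rewrite ?s1.
  case: ifP => Du; first by apply: (in2 2 1); rewrite ?s1.
  have [Du1 | nDu_1] := boolP (D (u + 1)%R).
    by apply: (in2 1 3); rewrite ?s1 // !inE Du1 !orbT.
  by apply: (in2 2 2); rewrite // !inE wS (negPf nDu_1).
split; first by apply/step_arcP; exists 1; rewrite ?inE.
apply/forallP=> v; apply/andP=> -[/step_arcP[i]] /steps_bound/andP[i0 i4] ->.
case/step_arcP=> j /steps_bound/andP[j0 j4]; rewrite -addrA -natrD.
move/(@addr_nat_inj u 1 (i + j) isT); rewrite ltnS (leq_add i4 j4) => /(_ isT) ij.
by have := leq_add i0 j0; rewrite -ij.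
Qed.

Lemma aut_step_shift (f : {perm 'Z_N}) :
  f \in aut_digraph step_digraph -> forall u, (f u = u + f 0)%R.
Proof.
rewrite inE => /forallP f_arc.
have {}f_arc u v : step_arc (f u) (f v) = step_arc u v.
  exact/eqP/(forallP (f_arc u)).
have f_succ u : (f (u + 1) = f u + 1)%R.
  apply/step_succP; have /step_succP/andP[uu1 /forallP no2] := erefl (u + 1)%R.
  rewrite f_arc uu1; apply/forallP=> v.
  by rewrite -(permKV f v) !f_arc.
have f_nat k : (f k%:R = k%:R + f 0)%R.
  by elim: k => [|k IHk]; rewrite ?add0r // -natr1 f_succ IHk addrAC.
by move=> u; rewrite -(natr_Zp u).
Qed.

Lemma aut_step_D (f : {perm 'Z_N}) :
  f \in aut_digraph step_digraph -> forall u, D (f u) = D u.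
Proof.
move=> Af u; have f_shift := aut_step_shift Af.
(* The step set is {1, 2, 3} at a switched position, {1, 3, 4} just after one, and {1, 2, 4}
   elsewhere. *)
have DE x : D x = step_arc x (x + 2%:R)%R && step_arc x (x + 3%:R)%R.
  have in_steps k : k < 9 -> step_arc x (x + k%:R)%R = (k \in steps x).
    move=> k9; apply/step_arcP/idP=> [[j js] | ks]; last by exists k.
    move/addr_nat_inj=> -> //.
    by apply: leq_ltn_trans (proj2 (andP (steps_bound js))) _.
  rewrite !in_steps // !inE.
  have [Dx1 | nDx1] := boolP (D (x - 1)%R).
    by have:= D_sparse Dx1; rewrite subrK => /negPf->.
  by case: (D x).
have fD k : (f (u + k%:R) = f u + k%:R)%R.
  by rewrite f_shift [in RHS]f_shift addrAC.
have f_arc v : step_arc (f u) (f v) = step_arc u v.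
  by move: Af; rewrite inE => /forallP/(_ u)/forallP/(_ v)/eqP.
by rewrite !DE -!fD !f_arc.
Qed.

Lemma step_arcD d (u v : 'Z_N) : (forall w, D (w + d) = D w)%R ->
  step_arc (u + d)%R (v + d)%R = step_arc u v.
Proof.
move=> Dd; have stepsd : steps (u + d)%R = steps u.
  by rewrite /steps addrAC !Dd.
rewrite /step_arc stepsd -[RHS](mem_map (addIr d)) -map_comp.
by congr (_ \in _); apply: eq_map => k /=; rewrite addrAC.
Qed.

End ShiftedCirculant.

(** * Existence when the vertex number exceeds 8 *)

Lemma card_semiregular (T : finType) (H : {group {perm T}}) :
  semiregular_perm H -> #|T| = #|H| * num_orbits H.
Proof.
move=> sregH; rewrite -cardsT -(@acts_sum_card_orbit _ _ _ 'P H [set: T]); last first.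
  by apply/actsP=> a _ u; rewrite !inE.
rewrite (eq_bigr (fun=> #|H|)); last first.
  by move=> _ /imsetP[u _ ->]; rewrite -(card_orbit_stab 'P H u) sregH cards1 muln1.
rewrite sum_nat_const mulnC; congr (_ * _); rewrite /num_orbits.
by apply: eq_card=> O; apply/imsetP/imsetP=> -[u _ ->]; exists u.
Qed.

Lemma cyclic_admits_OmSR (gT : finGroupType) (G : {group gT}) (m : nat) :
  cyclic G -> 2 <= m -> 8 < #|G| * m -> admits_OmSR G m 3.
Proof.
move=> cycG m_ge2 N_gt8; set N := #|G| * m in N_gt8.
have N_gt1 : 1 < N by apply: leq_trans N_gt8.
have m_gt0 : 0 < m by apply: leq_trans m_ge2.
have dvdmN : m %| N by apply: dvdn_mull.
(* Since [m] divides [N], this respects residues; since [m >= 2], no two switched positions are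
   consecutive. *)
pose D : pred 'Z_N := fun u => m %| u.
have dvdZ k : (m %| (k%:R : 'Z_N)%R) = (m %| k).
  by rewrite val_Zp_nat // /dvdn modn_dvdm.
have D_add (u : 'Z_N) k : D (u + k%:R)%R = (m %| u + k).
  by rewrite -{1}(natr_Zp u) -natrD /D dvdZ.
have D_sparse (u : 'Z_N) : D u -> ~~ D (u + 1)%R.
  by move=> Du; rewrite (D_add u 1) dvdn_addr // dvdn1 gtn_eqF.
pose Gamma := step_digraph D.
pose rho : {perm 'Z_N} := perm (addIr (m%:R : 'Z_N)%R).
have rhoX k u : (((rho ^+ k)%g : {perm 'Z_N}) u = u + (k * m)%:R)%R.
  elim: k => [|k IHk]; first by rewrite expg0 perm1 mul0n addr0.
  by rewrite expgSr permM IHk permE mulSn addnC natrD addrA.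
have natr_eq0 k : (k%:R == 0 :> 'Z_N)%R = (N %| k).
  by rewrite -val_eqE /= val_Zp_nat.
have rhoX_fix k u : ((rho ^+ k)%g : {perm 'Z_N}) u = u -> (rho ^+ k = 1)%g.
  rewrite rhoX -[u in _ = u](addr0 u) => /addrI km0.
  by apply/permP=> v; rewrite rhoX km0 addr0 perm1.
have o_rho : #[rho]%g = #|G|.
  apply/eqP; rewrite eqn_dvd.
  have dvdX k : (#[rho]%g %| k) = (#|G| %| k).
    rewrite order_dvdn -(dvdn_pmul2r m_gt0) -natr_eq0.
    apply/eqP/eqP=> [rk1 | km0]; last by apply: (rhoX_fix k 0%R); rewrite rhoX km0 addr0.
    by have := rhoX k 0%R; rewrite rk1 perm1 add0r.
  by rewrite dvdX dvdnn -dvdX dvdnn.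
have sreg : semiregular_perm <[rho]>%G.
  move=> u; apply/trivgP/subsetP=> s /setIP[/cycleP[k ->]].
  by move=> /astab1P; rewrite /= /aperm => /rhoX_fix->; rewrite inE.
have autE : aut_digraph Gamma = <[rho]>%g.
  apply/setP=> f; apply/idP/cycleP=> [Af | [k ->]].
    have f_shift := aut_step_shift N_gt8 D_sparse Af.
    (* Position 0 is switched, hence so is its image, and [f] translates by a multiple of [m]. *)
    have /dvdnP[k f0] : D (f 0%R).
      by rewrite (aut_step_D N_gt8 D_sparse Af) /D dvdn0.
    by exists k; apply/permP=> u; rewrite rhoX f_shift -f0 natr_Zp.
  rewrite inE; apply/forallP=> u; apply/forallP=> v; rewrite !rhoX.
  apply/eqP/step_arcD => w.
  by rewrite D_add dvdn_addl // dvdn_mull.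
have card_rho : #|<[rho]>%g| = #|G| by [].
have isoG : <[rho]>%g \isog G.
  by rewrite (isog_cyclic_card _ (cycle_cyclic rho)) cycG card_rho eqxx.
exists Gamma; split.
- exact: step_oriented.
- by move=> v; rewrite step_out_card // step_in_card.
- exists <[rho]>%G; split=> //; first by rewrite autE.
  have cardV : #|'Z_N| = #|G| * m by rewrite card_ord Zp_cast.
  have := card_semiregular sreg; rewrite cardV card_rho => /eqP.
  by rewrite eqn_pmul2l ?cardG_gt0 // => /eqP.
by rewrite /= autE.
Qed.

(** * Encoding and enumeration of the digraphs on 8 vertices *)

Fixpoint bitseqs n : seq bitseq :=
  if n is n'.+1 then [seq s :: b | s <- [:: false; true], b <- bitseqs n'] else [:: [::]].

Lemma mem_bitseqs (b : bitseq) : b \in bitseqs (size b).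
Proof.
elim: b => // s b IHb /=; rewrite cats0 mem_cat.
by case: s; rewrite ?map_f ?orbT.
Qed.

(* The code [(q, s)] stands for [tau ^ s (y q)], where [y 0, ..., y 3] represent
   the orbits of [tau].  A bit sequence lists, for [q < r] in lexicographic
   order and [s] in {false, true}, whether [(q, false) -> (r, s)] is an arc. *)
Definition codes : seq (nat * bool) := [seq (q, s) | s <- [:: false; true], q <- iota 0 4].

(** For [q < r < 4], the lexicographic rank of the pair is [r - 1] if [q = 0] and [q + r]
    otherwise. *)
Definition pair_bit (q r : nat) (s : bool) : nat := (if q is 0 then r.-1 else q + r).*2 + s.

(** Invariance under [tau] leaves only the xor of the exponents. Between distinct orbits exactly one
    direction is an arc, whence the negation; inside an orbit there is none. *)
Definition code_arc (b : bitseq) : rel (nat * bool) := fun c d =>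
  if c.1 < d.1 then nth false b (pair_bit c.1 d.1 (c.2 (+) d.2))
  else if d.1 < c.1 then ~~ nth false b (pair_bit d.1 c.1 (c.2 (+) d.2))
  else false.

(* [(o, f)] acts as an element of the wreath product of Z/2 by S_4, that is, of
   the centralizer of [tau]. *)
Definition code_act (p : seq nat * bitseq) (c : nat * bool) : nat * bool :=
  (nth 0 p.1 c.1, c.2 (+) nth false p.2 c.1).

Definition code_perms : seq (seq nat * bitseq) :=
  [seq (o, f) | o <- permutations (iota 0 4), f <- bitseqs 4].

(** Each code has 6 neighbours, so out-valency 3 forces in-valency 3, and [tau] carries the count to
    the other representatives. *)
Definition code_regular (b : bitseq) :=
  all (fun q => count (code_arc b (q, false)) codes == 3) (iota 0 4).

Definition code_aut (b : bitseq) (p : seq nat * bitseq) :=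
  all (fun c => all (fun d =>
    code_arc b (code_act p c) (code_act p d) == code_arc b c d) codes) codes.

(* No element of a semiregular group of exponent dividing 4 acts like this. *)
Definition code_bad (p : seq nat * bitseq) :=
  has (fun c => code_act p c != c) codes &&
  has (fun c => (code_act p c == c) || (iter 4 (code_act p) c != c)) codes.

(** Exhaustive check of the 2^12 bit sequences against the bad ones among the 4! * 2^4 elements of
    the wreath product. *)
Lemma code_regular_bad_aut :
  let ps := [seq p <- code_perms | code_bad p] in
  all (fun b => has (code_aut b) ps) [seq b <- bitseqs 12 | code_regular b].
Proof. by vm_compute. Qed.

Lemma code_act_perm :
  all (fun p => perm_eq (map (code_act p) codes) codes) code_perms.
Proof. by vm_compute. Qed.

Lemma uniq_map_inj_in (T1 T2 : eqType) (f : T1 -> T2) (s : seq T1) :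
  uniq (map f s) -> {in s &, injective f}.
Proof.
move=> uniq_fs x y xs ys fxy; rewrite -(nth_index x xs) -(nth_index x ys).
congr nth; apply/eqP; rewrite -(nth_uniq (f x) _ _ uniq_fs) ?size_map ?index_mem //.
by rewrite !(nth_map x) ?index_mem // !nth_index // fxy.
Qed.

Lemma nth_pair_bit (T : Type) (x0 : T) (f : nat -> nat -> bool -> T) q r s :
  q < r -> r < 4 ->
  nth x0 [:: f 0 1 false; f 0 1 true; f 0 2 false; f 0 2 true; f 0 3 false; f 0 3 true;
             f 1 2 false; f 1 2 true; f 1 3 false; f 1 3 true; f 2 3 false; f 2 3 true]
    (pair_bit q r s) = f q r s.
Proof. by case: q r s => [|[|[|[|q]]]] [|[|[|[|r]]]] []. Qed.

(** Greedy choice: the list built so far is closed under [tau], so a new [y] outside it brings a new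
    [tau y]. *)
Lemma uniq_orbit_reps (T : finType) (tau : T -> T) (k : nat) :
  involutive tau -> (forall v, tau v != v) -> k.*2 <= #|T| ->
  exists2 ys : seq T, size ys = k & uniq (ys ++ map tau ys).
Proof.
move=> tauK tau_fix; elim: k => [|k IHk] k2; first by exists [::].
have [|ys sz_ys uniq_ys] := IHk; first by rewrite doubleS in k2; lia.
have [y y_notin] : exists y, y \notin ys ++ map tau ys.
  apply/existsP; rewrite -negb_forall; apply/negP=> /forallP ysT.
  have ys_ge : #|T| <= #|ys ++ map tau ys| by apply/subset_leq_card/subsetP.
  have := leq_trans ys_ge (card_size _); rewrite size_cat size_map sz_ys; lia.
exists (y :: ys); first by rewrite /= sz_ys.
have tau_mem x : (x \in map tau ys) = (tau x \in ys).
  by rewrite -{1}(tauK x) mem_map //; apply: can_inj tauK.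
move: y_notin uniq_ys.
rewrite /= !cat_uniq /= !mem_cat !inE !tau_mem tauK !negb_or.
by case/andP=> -> -> /and3P[-> -> ->]; rewrite eq_sym tau_fix.
Qed.

(** * Impossibility on 8 vertices *)

Section EightVertices.

Variable Gamma : digraph.
Local Notation V := (vertex Gamma).
Hypotheses (orientedG : oriented Gamma) (regularG : regular Gamma 3).
Hypothesis cardV : #|V| = 8.
Variable tau : {perm V}.
Hypotheses (Atau : tau \in aut_digraph Gamma) (o_tau : #[tau]%g = 2).
Hypothesis sregG : semiregular_perm (aut_digraph_group Gamma).
Hypothesis expG : forall s, s \in aut_digraph Gamma -> (s ^+ 4 = 1)%g.

Let aut_arc s u v : s \in aut_digraph Gamma -> Defs.arc (s u) (s v) = Defs.arc u v.
Proof. by rewrite inE => /forallP/(_ u)/forallP/(_ v)/eqP. Qed.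

Let aut_fix s v : s \in aut_digraph Gamma -> s v = v -> s = 1%g.
Proof.
move=> As sv; apply/set1gP; rewrite -(sregG v) inE [s \in _]As.
by apply/astab1P.
Qed.

Let tauK : involutive tau.
Proof. by move=> v; rewrite -permM -[(_ * _)%g]/(tau ^+ 2)%g -o_tau expg_order perm1. Qed.

Let tau_fix v : tau v != v.
Proof. by apply/eqP=> /(aut_fix Atau) t1; move: o_tau; rewrite t1 order1. Qed.

Let arcC (u v : V) : Defs.arc u v -> ~~ Defs.arc v u.
Proof.
have [-> | uv] := eqVneq u v; first by rewrite (negPf (orientedG.2 v)).
by move=> auv; have := orientedG.1 u v uv; rewrite auv.
Qed.

(** The involution [tau] would reverse such an arc. *)
Let arc_tau (v : V) : ~~ Defs.arc v (tau v).
Proof.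
by apply/negP=> vt; have := arcC vt; rewrite -{2}(tauK v) aut_arc // vt.
Qed.

(** The vertices [u], [tau u] and the 6 neighbours of [u] already make 8; a further [v] not adjacent
    to [u] would be a ninth. *)
Let arc_total (u v : V) : u != v -> u != tau v -> Defs.arc u v = ~~ Defs.arc v u.
Proof.
move=> uv utv; apply/idP/idP=> [/arcC // | nvu].
apply/negPn/negP=> nuv.
pose N := out_neighbors u :|: in_neighbors u.
have cardN : #|N| = 6.
  rewrite cardsU !(proj1 (regularG u)) !(proj2 (regularG u)).
  rewrite (_ : _ :&: _ = set0) ?cards0 //; apply/setP=> w; rewrite !inE.
  by apply/andP=> -[/arcC/negPf->].
have N0 (w : V) : ~~ Defs.arc u w -> ~~ Defs.arc w u -> w \notin N.
  by rewrite !inE negb_or => -> ->.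
have tu_u : ~~ Defs.arc (tau u) u by rewrite -{2}(tauK u) arc_tau.
have vtu : tau u != v by rewrite -(inj_eq (can_inj tauK)) tauK.
have := max_card (tau u |: (v |: (u |: N))).
rewrite !cardsU1 cardN cardV !in_setU1 !negb_or !N0 ?arc_tau ?(negPf (orientedG.2 u)) //.
by rewrite vtu tau_fix eq_sym uv.
Qed.

Lemma no_eight_vertices : False.
Proof.
have [|ys sz_ys uniq_l] := uniq_orbit_reps (k := 4) tauK tau_fix; first by rewrite cardV.
case: ys => [|y0 ys] // in sz_ys uniq_l *.
pose e c := if c.2 then tau (nth y0 (y0 :: ys) c.1) else nth y0 (y0 :: ys) c.1.
have {sz_ys}uniq_l : uniq (map e codes).
  by case: ys => [|y1 [|y2 [|y3 []]]] // in sz_ys uniq_l e *.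
have e_inj := uniq_map_inj_in uniq_l.
have e_surj v : exists2 c, c \in codes & v = e c.
  apply/mapP; rewrite (_ : _ \in _ = (v \in V)) //; move: v.
  apply/subset_cardP; last by apply/subsetP.
  by rewrite cardV; apply/card_uniqP.
have codesE q s : (q, s) \in codes = (q < 4) by case: q s => [|[|[|[|q]]]] [].
have e_shift q r s t :
    Defs.arc (e (q, s)) (e (r, t)) = Defs.arc (e (q, false)) (e (r, s (+) t)).
  case: s t => -[] //; rewrite -[RHS](aut_arc _ _ Atau) //.
  by rewrite /e /= tauK.
pose f q r s := Defs.arc (e (q, false)) (e (r, s)).
pose b := [:: f 0 1 false; f 0 1 true; f 0 2 false; f 0 2 true; f 0 3 false; f 0 3 true;
              f 1 2 false; f 1 2 true; f 1 3 false; f 1 3 true; f 2 3 false; f 2 3 true].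
have e_arc c d : c \in codes -> d \in codes ->
    Defs.arc (e c) (e d) = code_arc b c d.
  case: c d => q s [r t]; rewrite !codesE => q4 r4; rewrite e_shift /code_arc /=.
  have [qr | rq | <-] := ltngtP q r.
  - by rewrite nth_pair_bit.
  - rewrite nth_pair_bit // /f arc_total.
    + by rewrite e_shift addbF.
    + apply/eqP=> /e_inj; rewrite !codesE => /(_ q4 r4)[qr _].
      by rewrite qr ltnn in rq.
    + have -> : tau (e (r, s (+) t)) = e (r, ~~ (s (+) t)).
        by rewrite /e /=; case: (s (+) t); rewrite ?tauK.
      apply/eqP=> /e_inj; rewrite !codesE => /(_ q4 r4)[qr _].
      by rewrite qr ltnn in rq.
  - case: (s (+) t); first by apply/negbTE; apply: arc_tau.
    exact/negbTE/(orientedG.2).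
have b_reg : code_regular b.
  apply/allP=> q; rewrite mem_iota => /andP[_ q4].
  rewrite -(regularG (e (q, false))).1.
  rewrite (eq_card (B := mem [seq v <- map e codes | Defs.arc (e (q, false)) v])).
    rewrite (card_uniqP (filter_uniq _ uniq_l)) size_filter count_map.
    by apply/eqP/eq_in_count=> c c_codes; rewrite /= e_arc // codesE.
  move=> v; rewrite inE mem_filter; have [c c_codes ->] := e_surj v.
  by rewrite map_f ?andbT.
have := allP code_regular_bad_aut b.
rewrite mem_filter b_reg => /(_ (mem_bitseqs b))/hasP[p].
rewrite mem_filter => /andP[/andP[/hasP[c0 c0_codes p_c0] /hasP[c1 c1_codes p_c1]] p_perm].
move=> /allP p_aut.
have p_codes := allP code_act_perm p p_perm.
have act_codes c : c \in codes -> code_act p c \in codes.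
  by move=> c_codes; rewrite -(perm_mem p_codes) map_f.
have act_inj : {in codes &, injective (code_act p)}.
  by apply: uniq_map_inj_in; rewrite (perm_uniq p_codes).
(* [dec] inverts [e], which transports the bad code automorphism [p] to a permutation of the
   vertices. *)
have [dec dec_codes e_dec] := fin_all_exists2 e_surj.
have dec_e c : c \in codes -> dec (e c) = c.
  by move=> c_codes; apply: e_inj; rewrite // -e_dec.
have s_inj : injective (fun v => e (code_act p (dec v))).
  move=> u v /e_inj euv; rewrite (e_dec u) (e_dec v); congr e.
  by apply: act_inj => //; apply: euv; apply: act_codes.
pose s := perm s_inj.
have sE c : c \in codes -> s (e c) = e (code_act p c).
  by move=> c_codes; rewrite permE dec_e.
have As : s \in aut_digraph Gamma.
  rewrite inE; apply/forallP=> u; apply/forallP=> v.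
  rewrite (e_dec u) (e_dec v) !sE // !e_arc ?act_codes //.
  by move/allP: (p_aut _ (dec_codes u)); apply.
(* Either [s] fixes a vertex and semiregularity applies, or its fourth power moves one, against
   [expG]. Being trivial then contradicts that [p] moves [c0]. *)
have s1 : s = 1%g.
  case/orP: p_c1 => [/eqP act_c1 | /eqP[]].
    by apply: (aut_fix (v := e c1) As); rewrite sE // act_c1.
  apply: e_inj => //; first by rewrite /= !act_codes.
  by rewrite -[RHS]perm1 -(expG As) !expgS expg0 mulg1 !permM !sE ?act_codes.
case/eqP: p_c0; apply: e_inj; rewrite ?act_codes //.
by rewrite -sE // s1 perm1.
Qed.

End EightVertices.

(** * Vertex counts and the classification *)

Lemma mCayley_card (gT : finGroupType) (G : {group gT}) (m : nat) (Gamma : digraph) :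
  mCayley_digraph G m Gamma -> #|vertex Gamma| = #|G| * m.
Proof. by case=> H [_ isoH /card_semiregular-> ->]; rewrite (card_isog isoH). Qed.

(** A vertex, its [k] out-neighbours and its [k] in-neighbours are all distinct. *)
Lemma oriented_regular_card (Gamma : digraph) (k : nat) :
  oriented Gamma -> regular Gamma k -> 2 * k < #|vertex Gamma|.
Proof.
move=> [no2 no1] reg; have /card_gt0P[u _] := vertex_gt0 Gamma.
have := max_card (u |: (out_neighbors u :|: in_neighbors u)).
rewrite cardsU1 !inE (negPf (no1 u)) cardsU !(proj1 (reg u)) !(proj2 (reg u)).
rewrite (_ : _ :&: _ = set0) ?cards0 ?subn0 ?addnn ?mul2n //.
apply/setP=> v; rewrite !inE; apply/negbTE.
by have [-> | /no2] := eqVneq u v; rewrite ?(negPf (no1 v)).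
Qed.

Lemma small_product_exceptions (n m : nat) : 1 < n -> 1 < m ->
  n * m <= 8 <-> (n = 2 /\ m <= 4) \/ ((n = 3 \/ n = 4) /\ m = 2).
Proof.
move=> n1 m1; split; last by case=> [[-> m4] | [[] -> ->]] //; lia.
by case: n n1 => [|[|[|[|[|n]]]]] // _; lia.
Qed.

Import GroupScope.

Theorem theorem1p1 (gT : finGroupType) (G : {group gT}) (x : gT) (m : nat)
    (defG : G :=: <[x]>) (ntG : G :!=: 1) (m_ge2 : 2 <= m) :
  admits_OmSR G m 3 <->
  ~ ((#[x] = 2 /\ m <= 4) \/ ((#[x] = 3 \/ #[x] = 4) /\ m = 2)).
Proof.
have oG : #|G| = #[x] by rewrite defG.
have o_gt1 : (1 < #[x])%N by rewrite -oG cardG_gt1.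
split=> [[Gamma [orG regG mCay isoA]] exc | exc]; last first.
  apply: cyclic_admits_OmSR => //; first by rewrite defG cycle_cyclic.
  by rewrite oG ltnNge; apply/negP=> /small_product_exceptions/exc; apply.
have cardV := mCayley_card mCay.
have V_gt6 := oriented_regular_card orG regG.
(* More than 6 vertices excludes 2 * 2, 2 * 3 and 3 * 2, leaving 2 * 4 and 4 * 2. *)
have [cardV8 o24] : #|vertex Gamma| = 8 /\ (#[x] = 2 \/ #[x] = 4).
  rewrite cardV oG in V_gt6 *.
  by case: exc V_gt6 => [[-> m4] | [[] -> ->]] // V_gt6; split; auto; lia.
case: mCay => H [sHA isoH sregH _].
have oA : #|aut_digraph Gamma| = #[x] by rewrite (card_isog isoA).
(* Both groups have the order of [G], so the full automorphism group is itself semiregular. *)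
have AH : aut_digraph_group Gamma = H.
  apply/val_inj/eqP; rewrite eq_sym eqEcard sHA /=.
  by rewrite oA (card_isog isoH) oG leqnn.
have [tau Atau o_tau] : {t | t \in aut_digraph_group Gamma & #[t] = 2}.
  by apply: Cauchy; rewrite //= oA; case: o24 => ->.
apply: (no_eight_vertices orG regG cardV8 Atau o_tau); first by rewrite AH.
move=> s As; apply/eqP; rewrite -order_dvdn.
apply: dvdn_trans (order_dvdG (As : s \in aut_digraph_group Gamma)) _.
by rewrite /= oA; case: o24 => ->.
Qed.
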